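(* Let $R$ be a finite commutative ring with unity. Then $\mathrm{Mdim}(Z(R)) = 1$ if and only if $R$ is isomorphic to one of the following rings: $\mathbb{Z}_6$, $\mathbb{Z}_8$, $\mathbb{Z}_9$, $\mathbb{Z}_2 \times \mathbb{Z}_2$, $\mathbb{Z}_3[r]/(r^2)$, $\mathbb{Z}_2[r]/(r^3)$, $\mathbb{Z}_4[r]/(2r, r^2-2)$.
   Context: $\mathbb{Z}_n$ denotes the ring of integers modulo $n$. For a commutative ring $R$ with unity, the zero-divisor graph $Z(R)$ is the simple undirected graph whose vertices are the nonzero zero divisors of $R$, two distinct vertices $x,y$ being adjacent if and only if $xy=0$. Multiset dimension: for a connected graph $G$ with distance function $d$, a vertex $v$ and a set $B \subseteq V(G)$, let $r_m(v\mid B)$ be the multiset of distances $\{d(v,b) : b \in B\}$ (counted with multiplicity). $B$ is an $m$-resolving set of $G$ if $r_m(u\mid B) \neq r_m(v\mid B)$ for all distinct vertices $u,v$ of $G$. $\mathrm{Mdim}(G)$ is the minimum cardinality of an $m$-resolving set, and $\mathrm{Mdim}(G)=\infty$ if $G$ has no $m$-resolving set. By convention, $\mathrm{Mdim}$ of a single-vertex graph is $0$, and $\mathrm{Mdim}$ of the graph with no vertices is undefined (so it is not equal to $1$). *)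

(* Defs.v *)
From HB Require Import structures.
From mathcomp Require Import all_boot all_algebra.
From mathcomp Require Import generic_quotient ring_quotient qpoly.
From mathcomp Require Import boolp.

Set Implicit Arguments.
Unset Strict Implicit.
Unset Printing Implicit Defensive.

Import GRing.Theory.
Local Open Scope ring_scope.

Section MultisetDimension.
Variables (T : finType) (e : rel T).

(* In a finite graph a shortest path has fewer than #|T| edges, so lengths
   below #|T| suffice; the value is #|T| if y is not reachable from x. *)
Definition gdist (x y : T) : nat :=
  find (fun n => [exists p : n.-tuple T, path e x p && (last x p == y)])
       (iota 0 #|T|).

Definition gconnected : bool := [forall x, forall y, connect e x y].

(* Multisets are represented by sequences, compared with perm_eq. *)
Definition mrep (v : T) (B : {set T}) : seq nat := [seq gdist v b | b in B].

Definition m_resolving (B : {set T}) : bool :=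
  [forall u, forall v, (u != v) ==> ~~ perm_eq (mrep u B) (mrep v B)].

Variant mdim := MdimUndefined | MdimInfinite | MdimFinite of nat.

(* Mdim is defined for nonempty connected graphs only. *)
Definition Mdim : mdim :=
  if (#|T| == 0)%N || ~~ gconnected then MdimUndefined
  else if [pick B | m_resolving B] is Some B0 then
    MdimFinite #|[arg min_(B < B0 | m_resolving B) #|B|]|
  else MdimInfinite.

End MultisetDimension.

Section ZeroDivisorGraph.
Variable R : finComPzRingType.

Definition nz_zero_divisor (x : R) : bool :=
  (x != 0) && [exists y : R, (y != 0) && (x * y == 0)].

Definition zdg_vertex : finType := {x : R | nz_zero_divisor x}.

Definition zdg_adj : rel zdg_vertex :=
  fun x y => (x != y) && (val x * val y == 0).

Definition Mdim_zdg : mdim := Mdim zdg_adj.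

End ZeroDivisorGraph.

Definition ring_iso (R S : pzRingType) : Prop :=
  exists f : {rmorphism R -> S}, bijective f.

Section TwoGeneratedIdeal.
Variable A : comNzRingType.

Definition ideal2 (a b : A) : {pred A} :=
  fun x => `[< exists u v : A, x = u * a + v * b >].

Lemma ideal2_closed (a b : A) : 1 \notin ideal2 a b -> idealr_closed (ideal2 a b).
Proof.
move=> n1; split=> //.
  by apply/asboolP; exists 0, 0; rewrite !mul0r addr0.
move=> c _ _ /asboolP[u [v ->]] /asboolP[u' [v' ->]]; apply/asboolP.
exists (c * u + u'), (c * v + v').
by rewrite mulrDr !mulrDl !mulrA addrACA.
Qed.

End TwoGeneratedIdeal.

Definition ideal_2r_r2m2 : {pred {poly 'Z_4}} := ideal2 (2 *: 'X) ('X^2 - 2%:P).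

Fact ideal_2r_r2m2_closed : idealr_closed ideal_2r_r2m2.
Proof.
apply: ideal2_closed; apply/asboolP => -[u [v]].
move=> /(congr1 (fun p : {poly 'Z_4} => 2 * p.[0])); rewrite !hornerE /=.
have two2 : 2 * 2 = 0 :> 'Z_4 by apply/eqP.
by rewrite mulr0 add0r expr0n sub0r mulrCA mulrN two2 oppr0 mulr0 => /eqP.
Qed.

HB.instance Definition _ :=
  isIdealr.Build {poly 'Z_4} ideal_2r_r2m2 ideal_2r_r2m2_closed.

Definition Z4r_quot : comNzRingType := {ideal_quot ideal_2r_r2m2}.

(* {poly %/ p} is the quotient by (p) only when p is monic and nonconstant,
   which holds for the powers of 'X used here. *)
Definition Z3r_quot : comNzRingType := {poly %/ ('X^2 : {poly 'Z_3})}.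
Definition Z2r_quot : comNzRingType := {poly %/ ('X^3 : {poly 'Z_2})}.

(* Main.v *)
Require Import Defs.
From HB Require Import structures.
From mathcomp Require Import all_boot all_algebra.
From mathcomp Require Import generic_quotient ring_quotient qpoly.
From mathcomp Require Import ring zify.

(* Mdim = 1 means that some vertex b has pairwise distinct distances to all
   vertices, i.e. the graph is a path with end b.  If v is the neighbour of b,
   then ann(b) is contained in {0, b, v} and ann(v) has at most one element
   outside {0, b, v}.  Since xv lies in ann(b) for every x, the whole ring is
   covered by at most three translates of ann(v), and it is determined by
   whether b^2 = 0 (order 9), v^2 = v (orders 4 and 6) or v^2 = 0 (order 8);
   v^2 = b would force b^2 = 0.  In the last case b^2 = v: the alternative
   b^2 = b + v makes e = b + v idempotent, and then 1 - e and 1 - e + v are two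
   vertices at distance 3 from b. *)

Set Implicit Arguments.
Unset Strict Implicit.
Unset Printing Implicit Defensive.

Import GRing.Theory.

(** * Distances in a finite graph, and graphs of multiset dimension one *)

Section GraphDistance.
Variables (T : finType) (e : rel T).

Lemma gdist_le x y p : path e x p -> last x p = y -> gdist e x y <= size p.
Proof.
move=> ep lp; rewrite /gdist; set P := (fun n => _).
(* For a walk of length at least [#|T|] the bound is trivial: [find] never exceeds the length of the
   list it searches. *)
have [p_small|p_big] := ltnP (size p) #|T|; last first.
  by apply: leq_trans p_big; rewrite -[X in _ <= X](size_iota 0) find_size.
rewrite leqNgt; apply/negP => /(before_find 0); rewrite nth_iota // add0n.
by move=> /existsP[]; exists (in_tuple p); rewrite /= ep lp eqxx.
Qed.

Lemma gdistP x y : gdist e x y < #|T| ->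
  exists2 p, path e x p /\ last x p = y & size p = gdist e x y.
Proof.
rewrite /gdist; set P := (fun n => _) => lt_d.
have hP : has P (iota 0 #|T|) by rewrite has_find size_iota.
have := nth_find 0 hP; rewrite nth_iota // add0n.
by move=> /existsP[p /andP[ep /eqP lp]]; exists p; rewrite ?size_tuple.
Qed.

Lemma gdistxx x : gdist e x x = 0.
Proof. by apply/eqP; rewrite -leqn0 (@gdist_le _ _ [::]). Qed.

Lemma gdist0_eq x y : gdist e x y = 0 -> x = y.
Proof.
move=> d0; have [|p [_ lp]] := @gdistP x y; first by rewrite d0; apply/card_gt0P; exists x.
by rewrite d0 => /size0nil p0; rewrite -lp p0.
Qed.

Lemma gdist1_adj x y : 1 < #|T| -> gdist e x y = 1 -> e x y.
Proof.
move=> T2 d1; have [|p [ep lp]] := @gdistP x y; first by rewrite d1.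
by rewrite d1; case: p ep lp => [|z [|]] //= /andP[exz _] <-.
Qed.

Lemma m_resolving0 (x y : T) : m_resolving e set0 -> x = y.
Proof.
move=> /forallP/(_ x)/forallP/(_ y); case: eqVneq => //= _.
by rewrite /mrep /image_mem enum_set0.
Qed.

Lemma m_resolving1 b :
  reflect (injective (gdist e ^~ b)) (m_resolving e [set b]).
Proof.
have mrepE u : mrep e u [set b] = [:: gdist e u b].
  by rewrite /mrep /image_mem enum_set1.
apply: (iffP idP) => [res u v duv|inj].
  apply/eqP; move: res => /forallP/(_ u)/forallP/(_ v).
  by rewrite !mrepE [X in [:: X]]duv perm_refl implybF negbK.
apply/forallP => u; apply/forallP => v; apply/implyP => neq_uv.
by apply: contra neq_uv; rewrite !mrepE => /perm_small_eq-/(_ isT)[/inj->].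
Qed.

(** The minimum is 1 when some singleton resolves and [set0] does not. All multisets of distances to
    [set0] are empty, so [set0] resolves only graphs with at most one vertex. *)
Lemma Mdim1P : Mdim e = MdimFinite 1 <->
  [/\ gconnected e, 1 < #|T| & exists b, injective (gdist e ^~ b)].
Proof.
rewrite /Mdim; split.
  case: eqVneq => //= T0; case conn: gconnected => //=.
  case: pickP => // B0 resB0; case: arg_minnP => // B resB minB [cB].
  split=> //.
    rewrite ltn_neqAle lt0n T0 andbT eq_sym; apply/negP => /eqP T1.
    suff /minB : m_resolving e set0 by rewrite cB cards0.
    apply/forallP => u; apply/forallP => v; apply/implyP.
    by rewrite ((fintype_le1P (eq_leq T1)) u v) eqxx.
  have /cards1P[b EB] : #|B| == 1 by rewrite cB.
  by exists b; apply/m_resolving1; rewrite -EB.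
move=> [conn T2 [b /m_resolving1 resb]].
have -> : #|T| == 0 = false by case: #|T| T2.
rewrite conn /=; case: pickP => [B0 resB0|]; last by move=> /(_ [set b]); rewrite resb.
case: arg_minnP => // B resB minB; congr MdimFinite; apply/eqP.
rewrite eqn_leq -{1}(cards1 b) minB //= card_gt0; apply: contraL T2 => /eqP B0E.
by rewrite -leqNgt; apply/fintype_le1P => x y; apply: m_resolving0; rewrite -B0E.
Qed.

End GraphDistance.

(** * Dimension one expressed by conditions on zero divisors *)

Local Open Scope ring_scope.

(* The nonzero zero divisors form the path b - v - w; w = b encodes the path b - v. *)
Definition zd_path (S : pzRingType) (b v w : S) : Prop :=
  [/\ [&& b != 0, v != 0, w != 0, b != v & v != w], b * v = 0, v * w = 0,
      w = b \/ b * w <> 0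
    & forall x y : S, x <> 0 -> y <> 0 -> x * y = 0 -> x \in [:: b; v; w]].

(** Lets the path be exhibited in a concrete model: each clause is pulled back along the inverse of
    the isomorphism. *)
Lemma zd_path_iso (R S : pzRingType) (b v w : S) :
  ring_iso R S -> zd_path b v w -> exists b' v' w' : R, zd_path b' v' w'.
Proof.
move=> [f [g fK gK]] [/and5P[b0 v0 w0 bv vw] bv0 vw0 wb zd].
have fI := can_inj fK; have gI := can_inj gK.
have g0 : g 0 = 0 by rewrite -[RHS]fK rmorph0.
have gM x y : g (x * y) = g x * g y by apply: fI; rewrite rmorphM !gK.
exists (g b), (g v), (g w); split.
- by rewrite -!g0 !(inj_eq gI) b0 v0 w0 bv.
- by rewrite -gM bv0.
- by rewrite -gM vw0.
- case: wb => [->|bw]; [by left | right => H; apply: bw].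
  by apply: gI; rewrite gM H g0.
- move=> x y x0 y0 xy; have : f x \in [:: b; v; w].
    apply: (zd (f x) (f y)); first by move=> H; apply: x0; apply: fI; rewrite H rmorph0.
      by move=> H; apply: y0; apply: fI; rewrite H rmorph0.
    by rewrite -rmorphM xy rmorph0.
  by rewrite !inE => /or3P[] /eqP <-; rewrite fK eqxx ?orbT.
Qed.

Lemma nz_zero_divisorI (R : finComPzRingType) (x y : R) :
  x != 0 -> y != 0 -> x * y = 0 -> nz_zero_divisor x.
Proof.
by move=> x0 y0 xy; rewrite /nz_zero_divisor x0; apply/existsP; exists y; rewrite y0 xy eqxx.
Qed.

(** The end [b] resolves alone: [b] is at distance 0, [v] at distance 1, and [w], if it differs from
    [b], is not adjacent to [b] and so lies farther than 1. *)
Lemma zd_path_Mdim (R : finComPzRingType) (b v w : R) :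
  zd_path b v w -> Mdim_zdg R = MdimFinite 1.
Proof.
move=> [/and5P[b0 v0 w0 bv vw] bv0 vw0 wb zd]; apply/Mdim1P.
have zB := nz_zero_divisorI b0 v0 bv0; have zW : nz_zero_divisor w.
  by apply: (nz_zero_divisorI w0 v0); rewrite mulrC.
have zV := nz_zero_divisorI v0 w0 vw0.
pose B : zdg_vertex R := Sub b zB.
pose V : zdg_vertex R := Sub v zV.
pose W : zdg_vertex R := Sub w zW.
have vtx (x : zdg_vertex R) : [\/ x = B, x = V | x = W].
  case: x => x zx; have := zx => /andP[x0 /existsP[y /andP[y0 /eqP xy]]].
  have := zd _ _ (elimN eqP x0) (elimN eqP y0) xy; rewrite !inE.
  by case/or3P => /eqP E; [apply: Or31 | apply: Or32 | apply: Or33]; apply: val_inj.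
have eBV : zdg_adj B V by rewrite /zdg_adj -val_eqE /= bv bv0 eqxx.
have eVB : zdg_adj V B by rewrite /zdg_adj -val_eqE /= eq_sym bv mulrC bv0 eqxx.
have eVW : zdg_adj V W by rewrite /zdg_adj -val_eqE /= vw vw0 eqxx.
have eWV : zdg_adj W V by rewrite /zdg_adj -val_eqE /= eq_sym vw mulrC vw0 eqxx.
have T2 : (1 < #|zdg_vertex R|)%N.
  apply/card_gt1P; exists B, V; split=> //.
split=> //.
  have cV x : connect (@zdg_adj R) x V /\ connect (@zdg_adj R) V x.
    by case: (vtx x) => ->; split=> //; apply: connect1.
  apply/forallP => x; apply/forallP => y.
  exact: connect_trans (proj1 (cV x)) (proj2 (cV y)).
have dB := gdistxx (@zdg_adj R) B.
have neqVB : V <> B by move=> /(congr1 val) /= E; rewrite E eqxx in bv.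
have dV : gdist (@zdg_adj R) V B = 1%N.
  apply/eqP; rewrite eqn_leq (@gdist_le _ _ _ _ [:: B]) ?lt0n ?andbT //=; last by rewrite eVB.
  by apply/eqP => /gdist0_eq.
exists B; have dW : W = B \/ (gdist (@zdg_adj R) W B > 1)%N.
  case: (eqVneq W B) => [|nWB]; [by left | right].
  have bw : b * w <> 0.
    by case: wb => // E; case/eqP: nWB; apply: val_inj.
  rewrite ltnNge leq_eqVlt ltnS leqn0 negb_or; apply/andP; split; apply/eqP.
    by move=> /(gdist1_adj T2) /andP[_ /eqP /=]; rewrite mulrC.
  by move=> /gdist0_eq E; rewrite E eqxx in nWB.
move=> x y /= ; case: dW => [WB|dW]; case: (vtx x) => ->; case: (vtx y) => -> //;
  rewrite ?WB ?dB ?dV // => E; rewrite -?E ?dV ?dB // in dW; by rewrite E in dW.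
Qed.

(* The three closing clauses bound by one the number of vertices at distances
   1, 2 and 3 from the end vertex b. *)
Definition zd_end (S : pzRingType) (b v : S) : Prop :=
  [/\ [&& b != 0, v != 0 & b != v], b * v = 0,
      forall x : S, x * b = 0 -> x \in [:: 0; b; v],
      forall x y : S, x \notin [:: 0; b; v] -> y \notin [:: 0; b; v] ->
        x * v = 0 -> y * v = 0 -> x = y
    & forall u x y : S, u \notin [:: 0; b; v] -> u * v = 0 ->
        x \notin [:: 0; b; v; u] -> y \notin [:: 0; b; v; u] ->
        x * u = 0 -> y * u = 0 -> x = y].

(** Take for [b] the resolving vertex and for [v] a neighbour of it. Each of the last three clauses
    of [zd_end] compares vertices at equal distance from [b], which must coincide. *)
Lemma Mdim_zd_end (R : finComPzRingType) :
  Mdim_zdg R = MdimFinite 1 -> exists b v : R, zd_end b v.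
Proof.
move=> /Mdim1P[conn T2 [B dI]].
have adjC : symmetric (@zdg_adj R).
  by move=> x y; rewrite /zdg_adj eq_sym mulrC.
have [V BV] : exists V, zdg_adj B V.
  have /card_gt1P[x [y [_ _ neq_xy]]] := T2.
  have [U neq_UB] : exists U, U != B.
    by case: (eqVneq x B) neq_xy => [->|nB _]; [exists y; rewrite eq_sym | exists x].
  have /connectP[[|V p] /=] : connect (@zdg_adj R) B U.
    by move: conn => /forallP/(_ B)/forallP/(_ U).
  - by move=> _ E; rewrite E eqxx in neq_UB.
  by move=> /andP[BV _] _; exists V.
pose d := (gdist (@zdg_adj R))^~ B.
have dB : d B = 0%N by exact: gdistxx.
have d1 X : zdg_adj X B -> d X = 1%N.
  move=> XB; apply/eqP; rewrite eqn_leq (@gdist_le _ _ _ _ [:: B]) /= ?XB // lt0n -dB.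
  by rewrite (inj_eq dI); case/andP: XB.
have dV : d V = 1%N by rewrite d1 // adjC.
(* The walk through [V] bounds the distance by 2; by injectivity of [d], the values 0 and 1 are
   reserved for [B] and [V]. *)
have d2 X : X != B -> X != V -> zdg_adj X V -> d X = 2%N.
  move=> XB XV aXV; apply/eqP; rewrite eqn_leq (@gdist_le _ _ _ _ [:: V; B]) /= ?aXV 1?adjC ?BV //.
  by rewrite ltn_neqAle -{1}dV eq_sym (inj_eq dI) XV lt0n -dB (inj_eq dI).
have d3 U X : U != B -> U != V -> zdg_adj U V -> X != B -> X != V -> zdg_adj X U -> d X = 3%N.
  move=> UB UV aUV XB XV aXU; have dU := d2 _ UB UV aUV.
  apply/eqP; rewrite eqn_leq (@gdist_le _ _ _ _ [:: U; V; B]) /= ?aXU ?aUV 1?adjC ?BV //.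
  rewrite ltn_neqAle -{1}dU eq_sym (inj_eq dI); case/andP: aXU => -> _ /=.
  by rewrite ltn_neqAle -{1}dV eq_sym (inj_eq dI) XV lt0n -dB (inj_eq dI).
have vtx (x y : R) : x != 0 -> y != 0 -> x * y = 0 -> {X : zdg_vertex R | val X = x}.
  move=> x0 y0 xy.
  by exists (Sub x (nz_zero_divisorI x0 y0 xy) : zdg_vertex R).
have v0 (X : zdg_vertex R) : val X != 0 by have /andP[] := valP X.
have [neqBV /eqP bv0] := andP BV.
exists (val B), (val V); split; rewrite ?v0 ?val_eqE //.
- move=> x xb; rewrite !inE; case: eqVneq => //= x0.
  case: eqVneq => //= xB; have [X EX] := vtx _ _ x0 (v0 B) xb.
  rewrite -EX val_eqE; rewrite -EX val_eqE in xB.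
  by rewrite -(inj_eq dI) [X in _ == X]dV [X in X == _]d1 // /zdg_adj xB EX xb eqxx.
- move=> x y; rewrite !inE !negb_or => /and3P[x0 xB xV] /and3P[y0 yB yV] xv yv.
  have [X EX] := vtx _ _ x0 (v0 V) xv; have [Y EY] := vtx _ _ y0 (v0 V) yv.
  rewrite -?EX -?EY in xB xV xv yB yV yv *; congr (val _); apply: dI.
  by rewrite [LHS]d2 ?[RHS]d2 // /zdg_adj ?xv ?yv ?eqxx ?andbT.
- move=> u x y; rewrite !inE !negb_or => /and3P[u0 uB uV] uv.
  move=> /and4P[x0 xB xV xU] /and4P[y0 yB yV yU] xu yu.
  have [U EU] := vtx _ _ u0 (v0 V) uv.
  have [X EX] := vtx _ _ x0 u0 xu; have [Y EY] := vtx _ _ y0 u0 yu.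
  rewrite -?EX -?EY -?EU in uB uV uv xB xV xU xu yB yV yU yu *.
  congr (val _); apply: dI.
  by rewrite [LHS](d3 U) ?[RHS](d3 U) // /zdg_adj ?uv ?xu ?yu ?eqxx ?andbT.
Qed.

(** * Isomorphisms through common coordinates *)

(** The bijections [u] and [v] carry one and the same ring structure on [I], so decoding by [u] and
    encoding by [v] preserves it. The index [k] need only exist, so no operations on [I] have to be
    supplied. *)
Lemma ring_iso_coord (I : finType) (A S : pzRingType) (u : I -> A) (v : I -> S) :
  injective u -> injective v ->
  (forall x, exists i, x = u i) -> (forall y, exists i, y = v i) ->
  (exists2 k, 1 = u k & 1 = v k) ->
  (forall i j, exists2 k, u i + u j = u k & v i + v j = v k) ->
  (forall i j, exists2 k, u i * u j = u k & v i * v j = v k) ->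
  ring_iso A S.
Proof.
move=> uI vI uS vS [k1 u1 v1] uvD uvM.
have inv (B : pzRingType) (w : I -> B) : injective w ->
    (forall x, exists i, x = w i) -> {c | cancel c w & cancel w c}.
  move=> wI wS; have wSb x : exists i, x == w i by have [i ->] := wS x; exists i.
  have cK : cancel (fun x => xchoose (wSb x)) w.
    by move=> x; rewrite -(eqP (xchooseP (wSb x))).
  by exists (fun x => xchoose (wSb x)) => // i; apply: wI; rewrite cK.
have [c cK uK] := inv _ _ uI uS; have [c' c'K vK] := inv _ _ vI vS.
pose f x := v (c x).
have fD x y : f (x + y) = f x + f y.
  by rewrite /f; have [k] := uvD (c x) (c y); rewrite !cK => -> ->; rewrite uK.
have fM x y : f (x * y) = f x * f y.
  by rewrite /f; have [k] := uvM (c x) (c y); rewrite !cK => -> ->; rewrite uK.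
have fB : zmod_morphism f.
  move=> x y; apply: (addIr (f y)); by rewrite -fD !subrK.
have f1 : f 1 = 1 by rewrite /f u1 uK.
pose fa := GRing.isZmodMorphism.Build A S f fB.
pose fm := GRing.isMonoidMorphism.Build A S f (conj f1 fM).
pose F : {rmorphism A -> S} := HB.pack f fa fm.
exists F; exists (fun y => u (c' y)) => x; rewrite /= /f ?vK ?cK //.
by rewrite uK c'K.
Qed.

Lemma mulrn_ord_inj (V : zmodType) (n : nat) (y : V) :
  (forall k, (0 < k < n)%N -> y *+ k <> 0) ->
  injective (fun i : 'I_n => y *+ i).
Proof.
move=> nz i j; wlog le_ij : i j / (i <= j)%N.
  by move=> H E; case/orP: (leq_total i j) => [/H|/H] ->.
move=> E; apply: val_inj => /=; apply/eqP; rewrite eqn_leq le_ij leqNgt /=.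
apply/negP => lt_ij; apply: (nz (j - i)%N); first by have := ltn_ord j; lia.
by rewrite mulrnBr // E subrr.
Qed.

Lemma ring_iso_Zn (A : pzRingType) (n : nat) : (1 < n)%N -> n%:R = 0 :> A ->
  (forall k, (0 < k < n)%N -> k%:R <> 0 :> A) ->
  (forall x : A, exists k : nat, x = k%:R) -> ring_iso A 'Z_n.
Proof.
(* For an index of the shape [n.+2] the type ['Z_n.+2] is the ordinal type itself, and the identity
   serves as its coordinate map. *)
case: n => [|[|n]] // _ n0 nz gen.
have modA k : (k %% n.+2)%:R = k%:R :> A.
  by rewrite [in RHS](divn_eq k n.+2) natrD natrM n0 mulr0 add0r.
apply: (@ring_iso_coord 'I_n.+2 A 'Z_n.+2 (fun i => (i : nat)%:R) id) => //.
- exact: mulrn_ord_inj.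
- by move=> x; have [k ->] := gen x; exists (inZp k); rewrite /= modA.
- by move=> y; exists y.
- by exists 1.
- by move=> i j; exists (i + j); rewrite //= modA natrD.
- by move=> i j; exists (i * j); rewrite //= modA natrM.
Qed.

(** * Dual numbers over the field with three elements *)

Lemma mulr2n_eq0 (A : pzRingType) (b : A) : 3%:R = 0 :> A -> b *+ 2 = 0 -> b = 0.
Proof.
move=> t0 E; transitivity (b *+ 3); first by rewrite mulrS E addr0.
by rewrite -mulr_natr t0 mulr0.
Qed.

Definition dual_coord (A : pzRingType) (b : A) (i : 'I_3 * 'I_3) : A :=
  i.1%:R + b *+ i.2.

(** This describes [Z_3[r]/(r^2)], with [b] the class of [r]. *)
Definition dual_gen (A : pzRingType) (b : A) : Prop :=
  [/\ b <> 0, b * b = 0, 3%:R = 0 :> A & forall x, exists i, x = dual_coord b i].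

(** Allowing arbitrary natural coefficients lets sums and products be settled by ring identities
    instead of tables. *)
Lemma dual_coordE (A : comNzRingType) (b : A) (c d : nat) : 3%:R = 0 :> A ->
  dual_coord b (inZp c, inZp d) = c%:R + b *+ d.
Proof.
move=> t0; have modA k : (k %% 3)%:R = k%:R :> A.
  by rewrite [in RHS](divn_eq k 3) natrD natrM t0 mulr0 add0r.
by rewrite /dual_coord /= -(mulr_natr b (d %% 3)) !modA mulr_natr.
Qed.

Lemma dual_coord_inj (A : comNzRingType) (b : A) :
  dual_gen b -> injective (dual_coord b).
Proof.
move=> [b0 bb t0 _].
have nz (k : nat) : (0 < k < 3)%N -> b *+ k <> 0.
  case: k => [|[|[|k]]] // _ E; exact/b0/mulr2n_eq0.
move=> [i j] [i' j'] E.
(* Multiplying by [b] kills the second coordinate. *)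
have Ei : i = i'.
  apply: (mulrn_ord_inj nz); have /(congr1 (fun x => x * b)) := E.
  by rewrite /dual_coord /= !mulrDl !mulrnAl bb !mul0rn !addr0 !mul1r.
move: E; rewrite Ei => /addrI E; congr (_, _); exact: (mulrn_ord_inj nz) E.
Qed.

Lemma dual_gen_iso (A S : comNzRingType) (b : A) (b' : S) :
  dual_gen b -> dual_gen b' -> ring_iso A S.
Proof.
move=> gA gS; have [_ bA tA sA] := gA; have [_ bS tS sS] := gS.
apply: (ring_iso_coord (dual_coord_inj gA) (dual_coord_inj gS)) => //.
- by exists (inZp 1, inZp 0); rewrite dual_coordE // mulr0n addr0.
- move=> [i j] [i' j']; exists (inZp (i + i'), inZp (j + j'));
    rewrite dual_coordE // /dual_coord /= natrD mulrnDr addrACA //.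
- move=> [i j] [i' j']; exists (inZp (i * i'), inZp (i * j' + j * i'));
    rewrite dual_coordE // /dual_coord /=; [ring: bA | ring: bS].
Qed.

(** The nonzero multiples of [b] are [b] and [- b]. If the constant part [i] of [x] is 1 or 2, it
    can be cancelled: [x * y = 0] times [b] gives [b * y = 0], then [y *+ i = 0], so [y]
    vanishes. *)
Lemma dual_gen_zd_path (A : comNzRingType) (b : A) :
  dual_gen b -> zd_path b (- b) b.
Proof.
move=> [/eqP b0 bb t0 gen].
have bNb : b != - b.
  by apply: contra b0; rewrite -subr_eq0 opprK -mulr2n => /eqP/(mulr2n_eq0 t0) ->.
split; rewrite ?b0 ?oppr_eq0 ?b0 ?bNb 1?eq_sym ?bNb //.
- by rewrite mulrN bb oppr0.
- by rewrite mulNr bb oppr0.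
- by left.
move=> x y; have [[i j] ->] := gen x => x0 y0 xy.
have nz (z : A) : z *+ i = 0 -> (i != 0 :> nat)%N -> z = 0.
  case: i {xy x0} => [[|[|[|i]]] hi] //= z0 _; exact: mulr2n_eq0.
have [i0|i0] := eqVneq (i : nat) 0%N.
  move: x0; rewrite /dual_coord /= i0 add0r; case: j {xy} => [[|[|[|j]]] hj] //= _.
    by rewrite !inE eqxx.
  rewrite !inE -[b *+ 2]addr0 -(subrr b) addrA -mulrSr -mulr_natr t0 mulr0 add0r.
  by rewrite eqxx orbT.
case: y0; apply: (nz _ _ i0); have by0 : b * y = 0.
  apply: (nz _ _ i0); have := congr1 ( *%R b) xy; rewrite /dual_coord /= mulr0 => <-.
  by ring: bb.
rewrite -[RHS]xy /dual_coord /=; ring: by0.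
Qed.

(** * Rings of order eight generated by an element of cube zero *)

Definition chain_coord (A : pzRingType) (b : A) (i : 'I_2 * 'I_2 * 'I_2) : A :=
  i.1.1%:R + b *+ i.1.2 + (b * b) *+ i.2.

(* d = false describes Z_2[r]/(r^3), d = true describes Z_4[r]/(2r, r^2 - 2). *)
Definition chain_gen (A : pzRingType) (d : bool) (b : A) : Prop :=
  [/\ b * b <> 0, b * b * b = 0, 2%:R = (b * b) *+ d &
      forall x, exists i, x = chain_coord b i].

(** If [d = true], two equals [b * b], so reducing [c] modulo 2 carries [c./2] into the coefficient
    of [b * b]. The other two coefficients produce no carry, as 2 kills [b] and [b * b]. *)
Lemma chain_coordE (A : comNzRingType) (d : bool) (b : A) (c e f : nat) :
  b * b * b = 0 -> 2%:R = (b * b) *+ d ->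
  chain_coord b (inZp c, inZp e, inZp (f + d * c./2)) = c%:R + b *+ e + (b * b) *+ f.
Proof.
move=> b3 t; have b2 : b *+ 2 = 0 by rewrite -mulr_natr t; ring: b3.
have bb2 : (b * b) *+ 2 = 0 by ring: b2.
have modA z k : z *+ 2 = 0 -> z *+ (k %% 2) = z *+ k :> A.
  by move=> z0; rewrite [in RHS](divn_eq k 2) mulrnDr mulnC mulrnA z0 mul0rn add0r.
have cE : c%:R = (c %% 2)%:R + (b * b) *+ (d * c./2) :> A.
  rewrite [in LHS](divn_eq c 2) divn2 natrD natrM t; ring.
by rewrite /chain_coord /= (modA b) // (modA (b * b)) // cE mulrnDr; ring.
Qed.

(** Multiplying by [b * b] isolates the constant coefficient; once it is cancelled, multiplying by
    [b] isolates the linear one. *)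
Lemma chain_coord_inj (A : comNzRingType) (d : bool) (b : A) :
  chain_gen d b -> injective (chain_coord b).
Proof.
move=> [bb0 b3 t _]; have b0 : b <> 0 by move=> E; rewrite E mul0r in bb0.
have nz (z : A) : z <> 0 -> forall k, (0 < k < 2)%N -> z *+ k <> 0.
  by move=> z0 [|[|k]].
move=> [[i j] k] [[i' j'] k'] E.
have Ei : i = i'.
  apply: (mulrn_ord_inj (nz _ bb0)); transitivity (chain_coord b (i, j, k) * (b * b)).
    by rewrite /chain_coord /=; ring: b3.
  by rewrite E /chain_coord /=; ring: b3.
move: E; rewrite Ei /chain_coord /= -!addrA => /addrI E.
have Ej : j = j'.
  apply: (mulrn_ord_inj (nz _ bb0)); transitivity ((b *+ j + b * b *+ k) * b); first by ring: b3.
  by rewrite E; ring: b3.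
move: E; rewrite Ej => /addrI E; congr (_, _, _).
exact: (mulrn_ord_inj (nz _ bb0)) E.
Qed.

Lemma chain_gen_iso (A S : comNzRingType) (d : bool) (b : A) (b' : S) :
  chain_gen d b -> chain_gen d b' -> ring_iso A S.
Proof.
move=> gA gS; have [_ bA tA sA] := gA; have [_ bS tS sS] := gS.
apply: (ring_iso_coord (chain_coord_inj gA) (chain_coord_inj gS)) => //.
- exists (inZp 1, inZp 0, inZp (0 + d * 1./2));
    by rewrite chain_coordE // !mulr0n !addr0.
- move=> [[i j] k] [[i' j'] k'].
  exists (inZp (i + i'), inZp (j + j'), inZp ((k + k') + d * (i + i')./2));
    by rewrite chain_coordE // /chain_coord /=; ring.
- move=> [[i j] k] [[i' j'] k'].
  exists (inZp (i * i'), inZp (i * j' + j * i'),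
    inZp ((i * k' + j * j' + k * i') + d * (i * i')./2));
    rewrite chain_coordE // /chain_coord /=; [ring: bA | ring: bS].
Qed.

(** Without constant term the nonzero elements are the three listed; with constant term 1 an element
    is a unit, its other part being nilpotent. *)
Lemma chain_gen_zd_path (A : comNzRingType) (d : bool) (b : A) :
  chain_gen d b -> zd_path b (b * b) (b + b * b).
Proof.
move=> [bb0 b3 t gen]; have b0 : b <> 0 by move=> E; rewrite E mul0r in bb0.
have bw : b * (b + b * b) = b * b by ring: b3.
split.
- apply/and5P; split; apply/eqP => // E; apply: bb0.
  + by rewrite -bw E mulr0.
  + by rewrite {1}E.
  + by case: b0; apply: (addIr (b * b)); rewrite -E add0r.
- by rewrite mulrA.
- by ring: b3.
- by right; rewrite bw.
move=> x y; have [[[i j] k] ->] := gen x => x0 y0 xy.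
move: x0 xy; rewrite /chain_coord /=.
case: i => [[|[|i]] hi] //=.
  by case: j k => [[|[|j]] hj] [[|[|k]] hk] //=;
    rewrite ?mulr0n ?add0r ?addr0 // => _ _; rewrite !inE eqxx ?orbT.
move=> _ xy; case: y0; move: xy; rewrite -addrA; set n := b *+ j + _ => xy.
have n3 : n * n * n = 0 by rewrite /n; ring: b3.
(* [1 - n + n * n] inverts [1 + n] because [n * n * n = 0]. *)
have : (1 - n + n * n) * ((1 + n) * y) = 0 by rewrite xy mulr0.
move=> <-; ring: n3.
Qed.

(** * Recognising [Z_9], [Z_8] and [Z_2 x Z_2] *)

(** Here [c] has additive order 3. If [k%:R = 0], multiplying by [c] shows that 3 divides [k], and
    then [c *+ (k %/ 3) = 0] shows that 9 does. *)
Lemma ring_iso_Z9 (A : comNzRingType) (c : A) :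
  c <> 0 -> c * c = 0 -> 3%:R = c -> (forall x, exists i j, x = i%:R + c *+ j) ->
  ring_iso A 'Z_9.
Proof.
move=> c0 cc tc gen; have c3 : c *+ 3 = 0 by rewrite -mulr_natr tc.
have c2 : c *+ 2 <> 0 by move=> E; apply: c0; move: c3; rewrite mulrS E addr0.
have nz k : c *+ k = 0 -> (k %% 3 = 0)%N.
  rewrite {1}(divn_eq k 3) mulrnDr mulnC mulrnA c3 mul0rn add0r.
  by have := ltn_pmod k (isT : (0 < 3)%N); case: (k %% 3)%N => [|[|[|]]].
apply: ring_iso_Zn => //.
- by rewrite (natrM _ 3 3) tc.
- move=> k k9 E; have k3 : (k = 3 * (k %/ 3))%N.
    have /nz : c *+ k = 0 by rewrite -mulr_natr E mulr0.
    by have := divn_eq k 3; lia.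
  have /nz : c *+ (k %/ 3) = 0 by rewrite -E [in RHS]k3 natrM tc mulr_natr.
  by lia.
- move=> x; have [i [j ->]] := gen x; exists (i + 3 * j)%N.
  by rewrite natrD natrM tc mulr_natr.
Qed.

(** Here [c * c] is 4 and has additive order 2. From [k%:R = 0], multiplying by [c * c], by [c] and
    by 1 in turn yields three factors 2 of [k]. *)
Lemma ring_iso_Z8 (A : comNzRingType) (c : A) :
  c * c <> 0 -> c * c * c = 0 -> 2%:R = c ->
  (forall x, exists i j k, x = i%:R + c *+ j + (c * c) *+ k) ->
  ring_iso A 'Z_8.
Proof.
move=> cc0 ccc tc gen; have cc2 : (c * c) *+ 2 = 0 by rewrite -mulr_natr tc.
have nz k : (c * c) *+ k = 0 -> (k %% 2 = 0)%N.
  rewrite {1}(divn_eq k 2) mulrnDr mulnC mulrnA cc2 mul0rn add0r.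
  by have := ltn_pmod k (isT : (0 < 2)%N); case: (k %% 2)%N => [|[|]].
apply: ring_iso_Zn => //.
- by rewrite (natrM _ 4 2) (natrM _ 2 2) tc.
- move=> k k8 E; have k2 : (k = 2 * (k %/ 2))%N.
    have /nz : (c * c) *+ k = 0 by rewrite -mulr_natr E mulr0.
    by have := divn_eq k 2; lia.
  have k4 : (k %/ 2 = 2 * (k %/ 2 %/ 2))%N.
    have /nz : (c * c) *+ (k %/ 2) = 0.
      transitivity (c * (2 * (k %/ 2))%:R); last by rewrite -k2 E mulr0.
      by rewrite natrM tc mulrA mulr_natr.
    by have := divn_eq (k %/ 2) 2; lia.
  have /nz : (c * c) *+ (k %/ 2 %/ 2) = 0.
    transitivity ((2 * 2 * (k %/ 2 %/ 2))%:R : A); first by rewrite !natrM tc mulr_natr.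
    by rewrite -mulnA -k4 -k2.
  by lia.
- move=> x; have [i [j [k ->]]] := gen x; exists (i + 2 * j + 2 * 2 * k)%N.
  by rewrite (natrD _ _ (2 * 2 * k)) (natrD _ i) !natrM tc !mulr_natr.
Qed.

Lemma ring_iso_Z2Z2 (A : comNzRingType) (f : A) :
  f <> 0 -> f <> 1 -> f * f = f -> 2%:R = 0 :> A ->
  (forall x : A, exists i j, x = i%:R * f + j%:R * (1 - f)) ->
  ring_iso A ('Z_2 * 'Z_2)%type.
Proof.
move=> f0 f1 ff t0 gen; have f'0 : 1 - f <> 0 by move/subr0_eq => E; apply: f1.
have modA k : (k %% 2)%:R = k%:R :> A.
  by rewrite [in RHS](divn_eq k 2) natrD natrM t0 mulr0 add0r.
pose u (i : 'Z_2 * 'Z_2) : A := f *+ i.1 + (1 - f) *+ i.2.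
have uE i j : u (inZp i, inZp j) = i%:R * f + j%:R * (1 - f).
  by rewrite -(modA i) -(modA j) /u /=; ring.
have nz (z : A) : z <> 0 -> forall k, (0 < k < 2)%N -> z *+ k <> 0.
  by move=> z0 [|[|k]].
apply: (@ring_iso_coord _ A _ u id) => //.
- move=> [i j] [i' j'] E; congr (_, _).
    apply: (mulrn_ord_inj (nz _ f0)); transitivity (u (i, j) * f).
      by rewrite /u /=; ring: ff.
    by rewrite E /u /=; ring: ff.
  apply: (mulrn_ord_inj (nz _ f'0)); transitivity (u (i, j) * (1 - f)).
    by rewrite /u /=; ring: ff.
  by rewrite E /u /=; ring: ff.
- by move=> x; have [i [j ->]] := gen x; exists (inZp i, inZp j).
- by move=> y; exists y.
- exists (inZp 1, inZp 1); [rewrite uE; ring | by apply/eqP].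
- move=> [i j] [i' j']; exists (inZp (i + i'), inZp (j + j')); last first.
    by apply: injective_projections; apply: val_inj.
  by rewrite uE /u /=; ring.
- move=> [i j] [i' j']; exists (inZp (i * i'), inZp (j * j')); last first.
    by apply: injective_projections; apply: val_inj.
  by rewrite uE /u /=; ring: ff.
Qed.

(** * Classification from an end vertex and its neighbour *)

(** Both [b + v] and [b + b] lie in ann(b), which forces [v = - b] and [b *+ 3 = 0]. As [x * b] is
    some [b *+ j], [x - j] lies in ann(b), so [x] is [j] plus a multiple of [b]. Finally 3 lies in
    ann(b): it is 0 for the dual numbers, and [b] or [- b] for [Z_9]. *)
Lemma zd_end_sq0 (A : comNzRingType) (b v : A) :
  zd_end b v -> b * b = 0 -> ring_iso A 'Z_9 \/ dual_gen b.
Proof.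
move=> [/and3P[/eqP b0 /eqP v0 /eqP bv] bv0 annb _ _] bb.
have vE : v = - b.
  have : b + v \in [:: 0; b; v] by apply: annb; ring: bb bv0.
  rewrite !inE => /or3P[] /eqP E.
  - by apply: (addrI b); rewrite E subrr.
  - by case: v0; apply: (addrI b); rewrite E addr0.
  - by case: b0; apply: (addIr v); rewrite E add0r.
have b3 : b *+ 3 = 0.
  have : b + b \in [:: 0; b; v] by apply: annb; ring: bb.
  rewrite !inE => /or3P[] /eqP E.
  - by case: bv; rewrite vE; apply: (addrI b); rewrite E subrr.
  - by case: b0; apply: (addrI b); rewrite E addr0.
  - by rewrite mulrS mulr2n E vE subrr.
have annbE x : x * b = 0 -> exists j : 'I_3, x = b *+ j.
  move=> /annb; rewrite vE !inE => /or3P[] /eqP ->.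
  - by exists (inZp 0).
  - by exists (inZp 1).
  - by exists (inZp 2); apply: (addrI b); rewrite subrr /= -mulrS b3.
have gen x : exists i j : 'I_3, x = i%:R + b *+ j.
  have [j xb] : exists j : 'I_3, x * b = b *+ j by apply: annbE; rewrite -mulrA bb mulr0.
  have [k xk] : exists k : 'I_3, x - j%:R = b *+ k.
    by apply: annbE; rewrite mulrBl xb mulr_natl subrr.
  by exists j, k; rewrite -xk addrC subrK.
have [j tb] : exists j : 'I_3, 3%:R = b *+ j by apply: annbE; rewrite mulr_natl.
have Nb : b *+ 2 = - b by apply: (addrI b); rewrite subrr -mulrS.
case: j tb => [[|[|[|j]]] hj] //= tb.
- by right; split=> // x; have [i [k ->]] := gen x; exists (i, k).
- left; apply: (ring_iso_Z9 b0 bb) => // x.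
  by have [i [k ->]] := gen x; exists i, k.
- left; apply: (@ring_iso_Z9 _ (- b)); rewrite ?mulrNN ?tb //.
    by move=> /eqP; rewrite oppr_eq0 => /eqP.
  move=> x; have [i [k ->]] := gen x; exists i, (2 * k)%N.
  rewrite -Nb -mulrnA (_ : (2 * (2 * k) = 3 * k + k)%N); last by lia.
  by rewrite mulrnDr (mulrnA b 3) b3 mul0rn add0r.
Qed.

(** Since [b] does not annihilate itself, ann(b) shrinks to {0, v}; this ideal contains [v *+ 2] and
    every [x * v]. *)
Lemma zd_end_ann (A : comNzRingType) (b v : A) :
  zd_end b v -> b * b <> 0 ->
  [/\ forall x, x * b = 0 -> x = 0 \/ x = v, v *+ 2 = 0
    & forall x, x * v = 0 \/ x * v = v].
Proof.
move=> [/and3P[_ /eqP v0 _] bv0 annb _ _] bb.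
have annbE x : x * b = 0 -> x = 0 \/ x = v.
  move=> xb; have := annb x xb; rewrite !inE => /or3P[] /eqP E; [left| |right] => //.
  by case: bb; rewrite -{1}E.
have vb0 : v * b = 0 by rewrite mulrC.
split=> // [|x]; last by apply: annbE; rewrite -mulrA vb0 mulr0.
have [] // : v *+ 2 = 0 \/ v *+ 2 = v by apply: annbE; rewrite mulrnAl vb0 mul0rn.
by rewrite mulr2n => E; case: v0; apply: (addrI v); rewrite E addr0.
Qed.

(** The idempotent [v] splits the ring into {0, v} and ann(v), the latter generated by [f = 1 - v].
    By [zd_end], ann(v) is {0, b} or {0, b, w}, a second factor of order 2 or 3. *)
Lemma zd_end_idem (A : comNzRingType) (b v : A) :
  zd_end b v -> b * b <> 0 -> v * v = v ->
  ring_iso A 'Z_6 \/ ring_iso A ('Z_2 * 'Z_2)%type.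
Proof.
move=> bvP bb vv; have [annbE v2 xvE] := zd_end_ann bvP bb.
have [/and3P[/eqP b0 /eqP v0 _] bv0 _ annv _] := bvP.
have vx x : exists i : nat, x * v = v *+ i.
  by have [->|->] := xvE x; [exists 0%N | exists 1%N].
pose f := 1 - v; have fv : f * v = 0 by rewrite /f; ring: vv.
have fb : f * b = b by rewrite /f; ring: bv0.
have ff : f * f = f by rewrite /f; ring: vv.
have f0 : f <> 0 by move=> E; rewrite E mul0r in fb; case: b0.
have f1 : f <> 1 by move=> E; rewrite E mul1r in fv.
have fin x : x * v = 0 -> x <> 0 -> x <> b -> x \notin [:: 0; b; v].
  move=> xv /eqP x0 /eqP xb; rewrite !inE (negPf x0) (negPf xb) /=.
  by apply/eqP => E; rewrite E vv in xv.
have [annv2|[w [wv w0 wb]]] : (forall x, x * v = 0 -> x = 0 \/ x = b) \/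
    exists w, [/\ w * v = 0, w <> 0 & w <> b].
  have [h|h] := boolp.pselect (exists w, [/\ w * v = 0, w <> 0 & w <> b]); [by right | left].
  move=> x xv; have [|x0] := eqVneq x 0; [by left|].
  have [|xb] := eqVneq x b; [by right|].
  by case: h; exists x; split=> //; apply/eqP.
- right; have fE : f = b by case: (annv2 f fv).
  have b2 : b *+ 2 = 0.
    have [] // := annv2 (b *+ 2) _; first by rewrite mulrnAl bv0 mul0rn.
    by rewrite mulr2n => E; case: b0; apply: (addrI b); rewrite E addr0.
  apply: (@ring_iso_Z2Z2 _ f) => //.
    have -> : 2%:R = f *+ 2 + v *+ 2 by rewrite /f; ring.
    by rewrite fE b2 v2 addr0.
  move=> x; have [i xv] := vx x.
  have [j xf] : exists j : nat, x * f = f *+ j.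
    have [->|->] : x * f = 0 \/ x * f = b by apply: annv2; rewrite -mulrA fv mulr0.
      by exists 0%N.
    by exists 1%N; rewrite fE.
  exists j, i; transitivity (x * f + x * v); first by rewrite /f; ring.
  by rewrite xf xv /f; ring.
- left; have nbw := annv _ _ (fin _ wv w0 wb).
  have annvE x : x * v = 0 -> [\/ x = 0, x = b | x = w].
    move=> xv; have [|/eqP x0] := eqVneq x 0; [by constructor 1|].
    have [|/eqP xb] := eqVneq x b; [by constructor 2|constructor 3].
    by rewrite (nbw x) // fin.
  have wE : w = - b.
    have [] : [\/ w + b = 0, w + b = b | w + b = w] by apply: annvE; ring: wv bv0.
    - by move=> E; apply: (addIr b); rewrite E addrC subrr.
    - by move=> E; case: w0; apply: (addIr b); rewrite E add0r.
    - by move=> E; case: b0; apply: (addrI w); rewrite E addr0.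
  have b3 : b *+ 3 = 0.
    have [] : [\/ b *+ 2 = 0, b *+ 2 = b | b *+ 2 = w] by apply: annvE; ring: bv0.
    - by rewrite mulr2n => E; case: wb; rewrite wE; apply: (addrI b); rewrite E subrr.
    - by rewrite mulr2n => E; case: b0; apply: (addrI b); rewrite E addr0.
    - by move=> E; rewrite mulrS E wE subrr.
  have Nb : - b = b *+ 2 by apply: (addrI b); rewrite subrr -mulrS.
  have [k fk] : exists k : nat, b = f *+ k.
    have [//|<-|E] := annvE f fv; first by exists 1%N.
    by exists 2%N; rewrite E wE mulNrn -Nb opprK.
  have f3 : f *+ 3 = 0.
    have [//|->//|E] := annvE f fv; by rewrite E wE mulNrn b3 oppr0.
  have f2 : f *+ 2 <> 0.
    by move=> E; apply: f0; move: f3; rewrite mulrS E addr0.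
  have fv1 : f + v = 1 by rewrite /f subrK.
  have natE n : n%:R = f *+ n + v *+ n :> A by rewrite -mulrnDl fv1.
  have mod3 n : f *+ n = f *+ (n %% 3).
    by rewrite {1}(divn_eq n 3) mulrnDr mulnC mulrnA f3 mul0rn add0r.
  have mod2 n : v *+ n = v *+ (n %% 2).
    by rewrite {1}(divn_eq n 2) mulrnDr mulnC mulrnA v2 mul0rn add0r.
  apply: ring_iso_Zn => //.
  + by rewrite natE (mulrnA f 3 2) f3 (mulrnA v 2 3) v2 !mul0rn addr0.
  + move=> n n6 E.
    have fn : f *+ n = 0 by rewrite -mulr_natr E mulr0.
    have vn : v *+ n = 0 by rewrite -mulr_natr E mulr0.
    move: fn vn; rewrite mod3 mod2; case: n n6 {E} => [|[|[|[|[|[|n]]]]]] //=.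
  + move=> x; have [i xv] := vx x.
    have [j xf] : exists j : nat, x * f = f *+ j.
      have [->|->|->] : [\/ x * f = 0, x * f = b | x * f = w].
        by apply: annvE; rewrite -mulrA fv mulr0.
      * by exists 0%N.
      * by exists k.
      * by exists (k * 2)%N; rewrite wE Nb mulrnA -fk.
    (* Chinese remainders: this is [j] modulo 3 and [i] modulo 2, the additive orders of [f] and
       [v]. *)
    exists (4 * j + 3 * i)%N; rewrite natE mod3 mod2.
    have -> : ((4 * j + 3 * i) %% 3 = j %% 3)%N by lia.
    have -> : ((4 * j + 3 * i) %% 2 = i %% 2)%N by lia.
    by rewrite -mod3 -mod2 -xf -xv -mulrDr fv1 mulr1.
Qed.

(** The one element of ann(v) outside {0, b, v} is [b + v]. Once [b * b = v], ann(v) thus consists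
    of combinations of [b] and [b * b], and it contains [x] or [x - 1] for every [x], which gives
    the coordinates of [chain_coord]. *)
Lemma zd_end_nilp (A : comNzRingType) (b v : A) :
  zd_end b v -> b * b <> 0 -> v * v = 0 ->
  ring_iso A 'Z_8 \/ exists d, chain_gen d b.
Proof.
move=> bvP bb vv; have [annbE v2 xvE] := zd_end_ann bvP bb.
have [/and3P[/eqP b0 /eqP v0 /eqP bv] bv0 _ annv annu] := bvP.
have vvE : v + v = 0 by rewrite -mulr2n.
have ws : b + v \notin [:: 0; b; v].
  rewrite !inE !negb_or; apply/and3P; split; apply/eqP => E.
  - by case: bv; apply: (addIr v); rewrite E vvE.
  - by case: v0; apply: (addrI b); rewrite E addr0.
  - by case: b0; apply: (addIr v); rewrite E add0r.
have wv : (b + v) * v = 0 by ring: bv0 vv.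
have annvE x : x * v = 0 -> x \in [:: 0; b; v; b + v].
  move=> xv; have [|xs] := boolP (x \in [:: 0; b; v]).
    by rewrite !inE => /or3P[] ->; rewrite ?orbT.
  by rewrite (annv _ _ xs ws xv wv) !inE eqxx !orbT.
have bbE : b * b = v.
  have : b * b \in [:: 0; b; v; b + v] by apply: annvE; ring: bv0.
  rewrite !inE => /or4P[] /eqP // E.
  (* If [b * b = b], then [1 - b] is in ann(b) = {0, v}, so 1 is [b] or [v + b]; either would
     annihilate [v]. *)
  - have [|E'] : 1 - b = 0 \/ 1 - b = v by apply: annbE; rewrite mulrBl mul1r E subrr.
      by move/subr0_eq => b1; case: v0; rewrite -[v]mul1r b1.
    by case: v0; rewrite -[v]mul1r -[1](subrK b) E' mulrDl vv bv0 addr0.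
  - have nin x : x * v = v -> x \notin [:: 0; b; v; b + v].
      move=> xv; rewrite !inE !negb_or; apply/and4P; split; apply/eqP => Ex;
        by case: v0; rewrite -xv Ex ?mul0r ?bv0 ?vv ?wv.
    case: v0; apply: (addrI (1 - (b + v))); rewrite addr0.
    by apply: (annu (b + v)) => //; try apply: nin; ring: bv0 vv E.
have bbb : b * b * b = 0 by rewrite bbE mulrC.
have bb2 : (b * b) *+ 2 = 0 by rewrite bbE.
have annE x : x * v = 0 -> exists i : 'I_2 * 'I_2, x = b *+ i.1 + (b * b) *+ i.2.
  move=> /annvE; rewrite bbE !inE => /or4P[] /eqP ->.
  - by exists (inZp 0, inZp 0); rewrite addr0.
  - by exists (inZp 1, inZp 0); rewrite addr0.
  - by exists (inZp 0, inZp 1); rewrite add0r.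
  - by exists (inZp 1, inZp 1).
have gen x : exists i, x = chain_coord b i.
  have [xv|xv] := xvE x.
    have [[i j] ->] := annE x xv; exists (inZp 0, i, j); by rewrite /chain_coord /= add0r.
  have [[i j] E] : exists i : 'I_2 * 'I_2, x - 1 = b *+ i.1 + (b * b) *+ i.2.
    by apply: annE; rewrite mulrBl xv mul1r subrr.
  exists (inZp 1, i, j); rewrite /chain_coord /= -addrA -E.
  by rewrite addrC subrK.
have [[i j] tE] : exists i : 'I_2 * 'I_2, 2%:R = b *+ i.1 + (b * b) *+ i.2.
  by apply: annE; rewrite mulr_natl.
(* The coefficient of [b] in 2 decides: if it is 0, that of [b * b] is the flag [d]; if it is 1, 2
   takes the place of [b] as generator and the ring is [Z_8]. *)
case: i tE => [[|[|i]] hi] //=.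
  by rewrite add0r => tE; right; exists (j == 1 :> nat); split=> //; case: j tE => [[|[|j]] hj].
case: j => [[|[|j]] hj] //= tE; left.
  rewrite addr0 in tE; apply: (@ring_iso_Z8 _ b) => // x.
  by have [[[i1 i2] i3] ->] := gen x; exists i1, i2, i3.
have cc : (b + b * b) * (b + b * b) = b * b by ring: bbb.
apply: (@ring_iso_Z8 _ (b + b * b)); rewrite ?cc //; first by ring: bbb.
(* With [c = b + b * b] one has [b = c + c * c], so the coefficient of [b] is added to that of the
   square. *)
move=> x; have [[[i1 i2] i3] ->] := gen x; exists i1, i2, (i2 + i3)%N.
by rewrite /chain_coord /=; ring: bb2.
Qed.

Lemma zd_end_iso (A : comNzRingType) (b v : A) :
  zd_end b v ->
  [\/ ring_iso A 'Z_6, ring_iso A 'Z_8, ring_iso A 'Z_9 | ring_iso A ('Z_2 * 'Z_2)%type]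
  \/ exists b : A, dual_gen b \/ exists d, chain_gen d b.
Proof.
move=> bvP; have [_ bv0 annb _ _] := bvP.
have [bb|/eqP bb] := eqVneq (b * b) 0.
  have [|bG] := zd_end_sq0 bvP bb; first by left; constructor 3.
  by right; exists b; left.
have : v * v \in [:: 0; b; v] by apply: annb; rewrite -mulrA [v * b]mulrC bv0 mulr0.
rewrite !inE => /or3P[] /eqP vv.
- have [|bG] := zd_end_nilp bvP bb vv; first by left; constructor 2.
  by right; exists b; right.
- by case: bb; rewrite -{2}vv mulrA bv0 mul0r.
- by left; have [] := zd_end_idem bvP bb vv; [constructor 1|constructor 4].
Qed.

(** * The listed rings: finite checks and polynomial quotients *)

Lemma zd_path_Z6 : zd_path (2 : 'Z_6) 3 4.
Proof.
split=> //; [exact/eqP | exact/eqP | by right | ].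
move=> x y /eqP + /eqP + /eqP.
by case: x => [[|[|[|[|[|[|x]]]]]] hx]; case: y => [[|[|[|[|[|[|y]]]]]] hy].
Qed.

Lemma zd_path_Z8 : zd_path (2 : 'Z_8) 4 6.
Proof.
split=> //; [exact/eqP | exact/eqP | by right | ].
move=> x y /eqP + /eqP + /eqP.
by case: x => [[|[|[|[|[|[|[|[|x]]]]]]]] hx]; case: y => [[|[|[|[|[|[|[|[|y]]]]]]]] hy].
Qed.

Lemma zd_path_Z9 : zd_path (3 : 'Z_9) 6 3.
Proof.
split=> //; [exact/eqP | exact/eqP | by left | ].
move=> x y /eqP + /eqP + /eqP.
by case: x => [[|[|[|[|[|[|[|[|[|x]]]]]]]]] hx]; case: y => [[|[|[|[|[|[|[|[|[|y]]]]]]]]] hy].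
Qed.

Lemma zd_path_Z2Z2 : zd_path ((1, 0) : 'Z_2 * 'Z_2) (0, 1) (1, 0).
Proof.
split=> //; [exact/eqP | exact/eqP | by left | ].
move=> x y /eqP + /eqP + /eqP.
by case: x => [[[|[|x]] hx] [[|[|x']] hx']]; case: y => [[[|[|y]] hy] [[|[|y']] hy']].
Qed.

Lemma polyC_Zp (n : nat) (A : nzRingType) (phi : {rmorphism {poly 'Z_n.+2} -> A})
  (c : 'Z_n.+2) : phi c%:P = c%:R.
Proof. by rewrite -{1}[c]natr_Zp polyC_natr rmorph_nat. Qed.

Lemma dual_gen_poly (A : comNzRingType) (phi : {rmorphism {poly 'Z_3} -> A}) :
  (forall x, exists p, x = phi p) -> phi 'X <> 0 -> phi 'X * phi 'X = 0 ->
  dual_gen (phi 'X).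
Proof.
move=> phiS b0 bb; have t0 : 3%:R = 0 :> A.
  by rewrite -(rmorph_nat phi) -polyC_natr pchar_Zp // rmorph0.
split=> // x; have [p ->] := phiS x; elim/poly_ind: p => [|p c [[i j] E]].
  by exists (inZp 0, inZp 0); rewrite dual_coordE // rmorph0 addr0.
exists (inZp c, inZp i); rewrite rmorphD rmorphM /= E polyC_Zp dual_coordE //.
by rewrite /dual_coord /=; ring: bb.
Qed.

(** Serves both quotients of order 8, over [Z_2] and over [Z_4]. Generation is by Horner induction:
    multiplying by [b] shifts the coefficients up one place, and the new constant [c] may carry into
    [b * b]. *)
Lemma chain_gen_poly (n : nat) (A : comNzRingType) (d : bool)
    (phi : {rmorphism {poly 'Z_n.+2} -> A}) (b := phi 'X) :
  (forall x, exists p, x = phi p) -> b * b <> 0 -> b * b * b = 0 ->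
  2%:R = (b * b) *+ d -> chain_gen d b.
Proof.
move=> phiS bb0 bbb tE; split=> // x; have [p ->] := phiS x.
elim/poly_ind: p => [|p c [[[i j] k] E]].
  exists (inZp 0, inZp 0, inZp (0 + d * 0./2)).
  by rewrite chain_coordE // rmorph0 !addr0.
exists (inZp c, inZp i, inZp (j + d * c./2)).
rewrite rmorphD rmorphM /= E polyC_Zp chain_coordE // -/b.
by rewrite /chain_coord /=; ring: bbb.
Qed.

Lemma in_qpoly_surj (A : comNzRingType) (h : {poly A}) (x : {poly %/ h}) :
  exists p, x = in_qpoly h p.
Proof.
exists (val x); apply: val_inj.
by rewrite /= Pdiv.CommonRing.rmodp_small ?size_mk_monic.
Qed.

Lemma in_qpolyXn_eq0 (A : comNzRingType) (n m : nat) :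
  (in_qpoly ('X^(n.+1) : {poly A}) 'X^m == 0) = (n < m)%N.
Proof.
rewrite -val_eqE /= mk_monic_Xn /=.
have [nm|mn] := ltnP n m; last first.
  by rewrite Pdiv.CommonRing.rmodp_small ?size_polyXn // -size_poly_eq0 size_polyXn.
rewrite -(subnK nm) exprD; apply/eqP; apply: Pdiv.RingMonic.rmodp_mull.
exact: monicXn.
Qed.

Lemma Z3r_dual_gen : dual_gen (in_qpoly ('X^2 : {poly 'Z_3}) 'X : Z3r_quot).
Proof.
apply: dual_gen_poly; first exact: in_qpoly_surj.
  exact/eqP/negbT/(in_qpolyXn_eq0 _ 1 1).
by rewrite -rmorphM; apply/eqP; rewrite (in_qpolyXn_eq0 _ 1 2).
Qed.

Lemma Z2r_chain_gen : chain_gen false (in_qpoly ('X^3 : {poly 'Z_2}) 'X : Z2r_quot).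
Proof.
apply: chain_gen_poly; first exact: in_qpoly_surj.
- by rewrite -rmorphM; apply/eqP; rewrite (in_qpolyXn_eq0 _ 2 2).
- by rewrite -!rmorphM -mulrA; apply/eqP; rewrite (in_qpolyXn_eq0 _ 2 3).
- by rewrite -(rmorph_nat (in_qpoly _)) -polyC_natr pchar_Zp // rmorph0.
Qed.

Lemma Xsqr_notin_ideal : 'X * 'X \notin ideal_2r_r2m2.
Proof.
apply/boolp.asboolP => -[u [v]].
(* The functional p |-> p_0 + 2 p_2 vanishes on the ideal but not at X^2. *)
move=> /(congr1 (fun p : {poly 'Z_4} => p`_0 + 2 * p`_2)).
have t4 : 2 * 2 = 0 :> 'Z_4 by apply/eqP.
rewrite !coefD -!scalerAr !mulrBr !coefB !coefZ -expr2.
rewrite !coefMC !coefMX !coefMXn !coefX /=.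
(* On a member of the ideal the constant coefficient of [v] cancels, leaving a multiple of 4. *)
set a := (X in _ = X); have -> : a = 2 * 2 * (u`_1 - v`_2) by rewrite /a; ring.
by rewrite t4 mul0r => /eqP.
Qed.

Local Open Scope quotient_scope.

Lemma Z4r_chain_gen : chain_gen true (\pi_Z4r_quot 'X : Z4r_quot).
Proof.
have piE (p : {poly 'Z_4}) : \pi_Z4r_quot p = 0 <-> p \in ideal_2r_r2m2.
  have pi0 : \pi_Z4r_quot 0 = 0 by exact: rmorph0.
  rewrite -pi0 -[p in p \in _]subr0 Quotient.idealrBE.
  by split=> [E|/eqP //]; apply/eqP.
apply: (@chain_gen_poly 2 Z4r_quot true \pi_Z4r_quot).
- by move=> x; exists (repr x); apply: esym; exact: reprK.
- by rewrite -rmorphM => /piE; apply/negP; exact: Xsqr_notin_ideal.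
(* Membership is witnessed by [r^3 = 1 * 2r + r * (r^2 - 2)]. *)
- rewrite -!rmorphM; apply/piE/boolp.asboolP; exists 1, 'X.
  by rewrite -mul_polyC mulrBr; ring.
- apply/esym/subr0_eq; rewrite -rmorphM -(rmorph_nat \pi_Z4r_quot) -rmorphB.
  by apply/piE/boolp.asboolP; exists 0, 1; rewrite mul0r add0r mul1r -expr2 polyC_natr.
Qed.

Theorem proposition3p1 (R : finComPzRingType) :
  Mdim_zdg R = MdimFinite 1 <->
    (ring_iso R 'Z_6 \/
     ring_iso R 'Z_8 \/
     ring_iso R 'Z_9 \/
     ring_iso R ('Z_2 * 'Z_2)%type \/
     ring_iso R Z3r_quot \/
     ring_iso R Z2r_quot \/
     ring_iso R Z4r_quot).
Proof.
split=> [/Mdim_zd_end[b [v bvP]]|].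
  (* The classification concerns nontrivial rings; [b != 0] gives [1 != 0], and [A] is [R]
     repackaged with this fact. *)
  have R1 : 1 != 0 :> R.
    case: bvP => /and3P[b0 _ _] _ _ _ _; apply: contra b0 => /eqP E.
    by rewrite -[b]mul1r E mul0r.
  pose A : comNzRingType := HB.pack R (GRing.PzSemiRing_isNonZero.Build R R1).
  have [[]|[c [cG|[[] cG]]]] := @zd_end_iso A b v bvP; do ?tauto.
  - by have := dual_gen_iso cG Z3r_dual_gen : ring_iso R Z3r_quot; tauto.
  - by have := chain_gen_iso cG Z4r_chain_gen : ring_iso R Z4r_quot; tauto.
  - by have := chain_gen_iso cG Z2r_chain_gen : ring_iso R Z2r_quot; tauto.
suff dimS (S : pzRingType) (b v w : S) : zd_path b v w -> ring_iso R S ->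
    Mdim_zdg R = MdimFinite 1.
  case=> [|[|[|[|[|[|]]]]]]; apply: dimS.
  - exact: zd_path_Z6.
  - exact: zd_path_Z8.
  - exact: zd_path_Z9.
  - exact: zd_path_Z2Z2.
  - exact: dual_gen_zd_path Z3r_dual_gen.
  - exact: chain_gen_zd_path Z2r_chain_gen.
  - exact: chain_gen_zd_path Z4r_chain_gen.
by move=> bvw isoRS; have [b' [v' [w' /zd_path_Mdim]]] := zd_path_iso isoRS bvw.
Qed.
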